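(* Let $G=(V,E)$ be a finite simple undirected graph and let $k,k'\geqslant 2$ be integers. Then every feasible solution $(x,y,z)$ of the 2L-PP on $G$ with parameters $k,k'$ satisfies the following inequalities. \begin{itemize} \item (``$y$-clique'' inequalities) For every clique $C\subseteq V$ of $G$ with $|C|>k$, writing $t=\lfloor |C|/k\rfloor$ and $r=|C| \bmod k$, $$ y(C)\;\geqslant\;\binom{t+1}{2}\,r+\binom{t}{2}\,(k-r). $$ \item (``$z$-clique'' inequalities) For every clique $C\subseteq V$ of $G$ with $|C|>kk'$, writing $T=\lfloor |C|/(kk')\rfloor$ and $R=|C| \bmod kk'$, $$ z(C)\;\geqslant\;\binom{T+1}{2}\,R+\binom{T}{2}\,(kk'-R). $$ \end{itemize}
   Context: Colours are the integers in $\{0,\ldots,kk'-1\}$. A feasible solution of the 2L-PP (2-level partition problem) on $G$ corresponds to an arbitrary assignment of one colour to each vertex (adjacent vertices may share a colour), encoded by binary variables as follows: for $v\in V$ and $c\in\{0,\ldots,kk'-1\}$, $x_{vc}=1$ if and only if $v$ has colour $c$; for each edge $\{u,v\}\in E$, $y_{uv}=1$ if and only if the colours of $u$ and $v$ are congruent modulo $k$, and $z_{uv}=1$ if and only if $u$ and $v$ have the same colour (otherwise these variables are $0$). A clique is a set of pairwise adjacent vertices of $G$. For a clique $C$, $y(C)=\sum_{\{u,v\}\subseteq C}y_{uv}$ and $z(C)=\sum_{\{u,v\}\subseteq C}z_{uv}$, the sums being over unordered pairs of distinct vertices of $C$. *)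

(* Defs.v *)
(* A finite simple graph on V is a symmetric irreflexive [rel V]. *)
From mathcomp Require Import all_boot.

Set Implicit Arguments.
Unset Strict Implicit.
Unset Printing Implicit Defensive.

Definition is_clique (V : finType) (e : rel V) (C : {set V}) : Prop :=
  {in C &, forall u v, u != v -> e u v}.

(* Edge variables are indexed by unordered pairs, i.e. two-element sets;
   only their values on edges are constrained. Booleans on the right-hand
   sides are coerced to 0 or 1 in [nat]. *)
Definition feasible_2LPP (V : finType) (e : rel V) (k k' : nat)
    (x : V -> 'I_(k * k') -> nat) (y z : {set V} -> nat) : Prop :=
  exists col : V -> 'I_(k * k'),
    [/\ forall v c, x v c = (col v == c),
        forall u v, e u v -> y [set u; v] = (col u == col v %[mod k])
      & forall u v, e u v -> z [set u; v] = (col u == col v)].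

Definition pair_sum (V : finType) (y : {set V} -> nat) (C : {set V}) : nat :=
  \sum_(p : {set V} | (p \subset C) && (#|p| == 2)) y p.

(* Main.v *)
Require Import Defs.
From mathcomp Require Import all_boot.
From mathcomp Require Import zify.

(** On a clique, [y] and [z] both record which pairs of vertices agree under a
map to a finite set: the colour modulo [k] for [y], the colour itself for [z].
Both inequalities are therefore one statement about a map [f] from a set [C]
to a type [J] with [m] elements: there are at least as many unordered pairs in
[C] on which [f] agrees as when the fibres of [f] are as equal in size as
possible.

If the fibres have sizes [n_j], the number of such pairs is the sum of the
['C(n_j, 2)] ([pair_sum_agree]), and the [n_j] add up to [#|C|]. By convexity,
['C(n, 2)] lies above the line through its values at [t] and [t + 1], namely
[t * n - 'C(t + 1, 2)] ([bin2_tangent]). Summing over [J] with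
[t = #|C| %/ m] leaves a bound that depends on [#|C|] only, and it is the
balanced value ([balanced_bin2]) because [t] and [t + 1] are exactly the fibre
sizes in a balanced distribution. *)

(** Doubled, the difference of the two sides is [(n - t) * (n - t - 1)], a
product of consecutive integers. *)
Lemma bin2_tangent (n t : nat) : t * n <= 'C(n, 2) + 'C(t.+1, 2).
Proof.
have := mul_bin_diag n 1; have := mul_bin_diag t.+1 1.
rewrite !bin1 /= => Ht Hn.
by case: (leqP n t) => ?; nia.
Qed.

(** The equality case of [bin2_tangent], summed over [r] parts of size [t + 1]
and [m - r] parts of size [t]: both sizes lie on the line. *)
Lemma balanced_bin2 (m t r : nat) : r <= m ->
  'C(t.+1, 2) * r + 'C(t, 2) * (m - r) + m * 'C(t.+1, 2) = t * (t * m + r).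
Proof.
move=> le_rm; have := mul_bin_diag t 1; rewrite binS !bin1 => Ht.
have {Ht} : 2 * 'C(t, 2) + t = t * t by case: t Ht => //= t; lia.
by move: 'C(t, 2) => b Hb; rewrite -{1}(subnK le_rm); nia.
Qed.

Section AgreeingPairs.

Variables (V J : finType) (f : V -> J) (w : {set V} -> nat) (C : {set V}).
Hypothesis w_agree : {in C &, forall u v, u != v -> w [set u; v] = (f u == f v)}.

Let fibre (j : J) : {set V} := [set v in C | f v == j].

(** A pair on which [f] agrees lies in exactly one fibre, any other pair in
none, so the pairs can be counted fibre by fibre. *)
Lemma pair_sum_agree : pair_sum w C = \sum_j 'C(#|fibre j|, 2).
Proof.
transitivity (\sum_(p : {set V} | (p \subset C) && (#|p| == 2))
                \sum_j (p \subset fibre j : nat)).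
  apply: eq_bigr => p /andP[sub_pC /cards2P[u [v [neq_uv def_p]]]].
  move: sub_pC; rewrite def_p subUset !sub1set => /andP[uC vC].
  rewrite w_agree // (bigD1 (f u)) //= big1 => [|j neq_j].
    by rewrite addn0 subUset !sub1set !inE uC vC eqxx eq_sym.
  by rewrite subUset !sub1set !inE uC eq_sym (negPf neq_j).
rewrite exchange_big /=; apply: eq_bigr => j _.
rewrite -cards_draws -sum1dep_card -big_mkcondr /=.
apply: eq_bigl => p; rewrite andbAC; congr (_ && _).
rewrite andb_idl // => /subset_trans; apply.
by apply/subsetP => v; rewrite inE => /andP[].
Qed.

Lemma sum_card_fibre : \sum_j #|fibre j| = #|C|.
Proof.
rewrite -sum1_card (partition_big f xpredT) //=.
by apply: eq_bigr => j _; rewrite sum1dep_card.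
Qed.

Lemma pair_sum_agree_ge (m := #|J|) (t := #|C| %/ m) (r := #|C| %% m) :
  0 < m -> 'C(t.+1, 2) * r + 'C(t, 2) * (m - r) <= pair_sum w C.
Proof.
move=> m_gt0; rewrite -(leq_add2r (m * 'C(t.+1, 2))).
rewrite balanced_bin2 ?[r <= m]ltnW ?ltn_pmod // -divn_eq.
rewrite pair_sum_agree -sum_nat_const -big_split /=.
rewrite -sum_card_fibre big_distrr /=.
by apply: leq_sum => j _; apply: bin2_tangent.
Qed.

End AgreeingPairs.

Arguments pair_sum_agree_ge {V J f w C} _ _.

Theorem proposition3p1 (V : finType) (e : rel V)
    (e_sym : symmetric e) (e_irr : irreflexive e)
    (k k' : nat) (hk : 2 <= k) (hk' : 2 <= k')
    (x : V -> 'I_(k * k') -> nat) (y z : {set V} -> nat)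
    (hxyz : feasible_2LPP e x y z) :
  (forall C : {set V}, is_clique e C -> k < #|C| ->
     let t := #|C| %/ k in
     let r := #|C| %% k in
     'C(t.+1, 2) * r + 'C(t, 2) * (k - r) <= pair_sum y C) /\
  (forall C : {set V}, is_clique e C -> k * k' < #|C| ->
     let T := #|C| %/ (k * k') in
     let R := #|C| %% (k * k') in
     'C(T.+1, 2) * R + 'C(T, 2) * (k * k' - R) <= pair_sum z C).
Proof.
have k_gt0 : 0 < k by apply: ltnW.
have kk_gt0 : 0 < k * k' by rewrite muln_gt0 k_gt0 ltnW.
case: hxyz => col [_ def_y def_z]; split=> C clC _ /=.
  pose f v := Ordinal (ltn_pmod (col v) k_gt0).
  have y_agree : {in C &, forall u v, u != v -> y [set u; v] = (f u == f v)}.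
    by move=> u v uC vC neq_uv; rewrite def_y //; apply: clC.
  by have := pair_sum_agree_ge y_agree; rewrite card_ord; apply.
have z_agree : {in C &, forall u v, u != v -> z [set u; v] = (col u == col v)}.
  by move=> u v uC vC neq_uv; rewrite def_z //; apply: clC.
by have := pair_sum_agree_ge z_agree; rewrite card_ord; apply.
Qed.
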